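(* Let $(\mathcal C,\otimes)$ be a category with a coherently associative product, let $T$ be a Hopf-like triple on $\mathcal C$ with structure transformation $\tau$, let $\mathcal A$ be the category of $T$-algebras in $\mathcal C$, $U:\mathcal A\to\mathcal C$ the forgetful functor, and $\bigcirc$ the product on $\mathcal A$ extending $\otimes$. Suppose that $\mathcal A$ has all coequalizers and that for every $A\in\mathcal A$ the functor $U(A)\otimes-:\mathcal C\to\mathcal C$ has a left adjoint. Then the functor $A\bigcirc-:\mathcal A\to\mathcal A$ has a left adjoint as well.
   Context: A coherently associative product on $\mathcal C$ is a bifunctor $\otimes:\mathcal C\times\mathcal C\to\mathcal C$ with a natural associativity isomorphism $a_{X,Y,Z}:(X\otimes Y)\otimes Z\to X\otimes(Y\otimes Z)$ satisfying the usual coherence (pentagon) condition; $\otimes$ is not assumed to be symmetric or to possess a unit object. A triple on $\mathcal C$ is a monoid with identity in the category of endofunctors of $\mathcal C$: a functor $T:\mathcal C\to\mathcal C$ with multiplication $\mu:T\circ T\to T$ and identity $\eta:\mathrm{Id}\to T$. A $T$-algebra is an object $A$ of $\mathcal C$ with a structure morphism $\alpha:T(A)\to A$ satisfying the usual axioms of an algebra over a triple. A Hopf-like triple on $(\mathcal C,\otimes)$ is a triple $T$ on $\mathcal C$ together with a natural transformation between bifunctors $\tau_{X,Y}:T(X\otimes Y)\to T(X)\otimes T(Y)$ satisfying the following two conditions: (a) $\tau_{X,Y}\circ\mu_{X\otimes Y}=(\mu_X\otimes\mu_Y)\circ\tau_{TX,TY}\circ T(\tau_{X,Y})$; (b) $(\mathrm{id}_{TX}\otimes\tau_{Y,Z})\circ\tau_{X,Y\otimes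 Z}\circ T(a_{X,Y,Z})=a_{TX,TY,TZ}\circ(\tau_{X,Y}\otimes\mathrm{id}_{TZ})\circ\tau_{X\otimes Y,Z}$. For $T$-algebras $(A,\alpha:T(A)\to A)$ and $(B,\beta:T(B)\to B)$ one defines $(A,\alpha)\bigcirc(B,\beta):=(A\otimes B,\ (\alpha\otimes\beta)\circ\tau_{A,B})$; on morphisms $f\bigcirc g=f\otimes g$.
   Formalization: Conditions (a) and (b) do not make the structure map of A○B unital (e.g. τ = 0 on pointed sets), so it is additionally assumed that A○B is a T-algebra for all T-algebras A, B, equivalently τ∘η = η⊗η. *)

(* Defs.v *)
From Stdlib Require Import ProofIrrelevance.

Set Implicit Arguments.
Unset Strict Implicit.
Unset Printing Implicit Defensive.

(** * Categories, functors, natural transformations *)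

Declare Scope cat_scope.
Delimit Scope cat_scope with cat.
Local Open Scope cat_scope.

Record Category := {
  Obj :> Type;
  Hom : Obj -> Obj -> Type;
  id : forall X : Obj, Hom X X;
  comp : forall X Y Z : Obj, Hom Y Z -> Hom X Y -> Hom X Z;
  comp_id_l : forall (X Y : Obj) (f : Hom X Y), comp (id Y) f = f;
  comp_id_r : forall (X Y : Obj) (f : Hom X Y), comp f (id X) = f;
  comp_assoc : forall (W X Y Z : Obj) (h : Hom Y Z) (g : Hom X Y) (f : Hom W X),
    comp h (comp g f) = comp (comp h g) f
}.
Arguments Hom {_} _ _.
Arguments id {_} _.
Arguments comp {_ _ _ _} _ _.

Notation "g ∘ f" := (comp g f) (at level 40, left associativity) : cat_scope.

Definition is_iso (C : Category) (X Y : C) (f : Hom X Y) : Prop :=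
  exists g : Hom Y X, g ∘ f = id X /\ f ∘ g = id Y.

Record Functor (C D : Category) := {
  fobj :> C -> D;
  fmap : forall X Y : C, Hom X Y -> Hom (fobj X) (fobj Y);
  fmap_id : forall X : C, fmap (id X) = id (fobj X);
  fmap_comp : forall (X Y Z : C) (g : Hom Y Z) (f : Hom X Y),
    fmap (g ∘ f) = fmap g ∘ fmap f
}.
Arguments fmap {_ _} _ {_ _} _.

Definition idF (C : Category) : Functor C C :=
  {| fobj := fun X : C => X;
     fmap := fun _ _ f => f;
     fmap_id := fun _ => eq_refl;
     fmap_comp := fun _ _ _ _ _ => eq_refl |}.

Definition compF (C D E : Category) (G : Functor D E) (F : Functor C D) :
  Functor C E.
Proof.
  refine {| fobj := fun X : C => G (F X);
            fmap := fun _ _ f => fmap G (fmap F f) |}.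
  - abstract (intros X; now rewrite !fmap_id).
  - abstract (intros X Y Z g f; now rewrite !fmap_comp).
Defined.

Record NatTrans (C D : Category) (F G : Functor C D) := {
  component :> forall X : C, Hom (F X) (G X);
  naturality : forall (X Y : C) (f : Hom X Y),
    component Y ∘ fmap F f = fmap G f ∘ component X
}.

Definition prodC (C D : Category) : Category.
Proof.
  refine {| Obj := (C * D)%type;
            Hom := fun p q => (Hom (fst p) (fst q) * Hom (snd p) (snd q))%type;
            id := fun p => (id (fst p), id (snd p));
            comp := fun _ _ _ g f => (fst g ∘ fst f, snd g ∘ snd f) |}.
  - abstract (intros X Y [f g]; cbn; now rewrite !comp_id_l).
  - abstract (intros X Y [f g]; cbn; now rewrite !comp_id_r).
  - abstract (intros W X Y Z [h h'] [g g'] [f f']; cbn; now rewrite !comp_assoc).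
Defined.

Section Bifunctor.
Variables (C D E : Category) (F : Functor (prodC C D) E).

Definition biobj (X : C) (Y : D) : E := fobj F (X, Y).

Definition bimap (X X' : C) (Y Y' : D) (f : Hom X X') (g : Hom Y Y') :
  Hom (biobj X Y) (biobj X' Y') :=
  @fmap _ _ F (X, Y) (X', Y') (f, g).

Lemma bimap_id X Y : bimap (id X) (id Y) = id (biobj X Y).
Proof. exact (fmap_id F (X, Y)). Qed.

Lemma bimap_comp (X X' X'' : C) (Y Y' Y'' : D) (f' : Hom X' X'') (f : Hom X X')
    (g' : Hom Y' Y'') (g : Hom Y Y') :
  bimap (f' ∘ f) (g' ∘ g) = bimap f' g' ∘ bimap f g.
Proof.
  exact (@fmap_comp _ _ F (X, Y) (X', Y') (X'', Y'') (f', g') (f, g)).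
Qed.

(** The functor [F(X, -)]. *)
Definition fix_left (X : C) : Functor D E.
Proof.
  refine {| fobj := fun Y : D => biobj X Y;
            fmap := fun _ _ g => bimap (id X) g |}.
  - abstract (intros Y; apply bimap_id).
  - abstract (intros Y Y' Y'' g f; rewrite <- bimap_comp; now rewrite comp_id_l).
Defined.
End Bifunctor.

(** [R] has a left adjoint, presented by unit, counit and triangle identities. *)
Definition has_left_adjoint (C D : Category) (R : Functor D C) : Prop :=
  exists (L : Functor C D)
         (eta : NatTrans (idF C) (compF R L))
         (eps : NatTrans (compF L R) (idF D)),
    (forall X : C, eps (L X) ∘ fmap L (eta X) = id (L X)) /\
    (forall Y : D, fmap R (eps Y) ∘ eta (R Y) = id (R Y)).

Definition is_coequalizer (C : Category) (X Y Q : C) (f g : Hom X Y)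
    (q : Hom Y Q) : Prop :=
  q ∘ f = q ∘ g /\
  forall (Z : C) (h : Hom Y Z), h ∘ f = h ∘ g ->
    exists! k : Hom Q Z, k ∘ q = h.

Definition has_coequalizers (C : Category) : Prop :=
  forall (X Y : C) (f g : Hom X Y),
    exists (Q : C) (q : Hom Y Q), is_coequalizer f g q.

(** * Coherently associative products *)

Record AssocProduct (C : Category) := {
  tensor :> Functor (prodC C C) C;
  assoc : forall X Y Z : C,
    Hom (biobj tensor (biobj tensor X Y) Z) (biobj tensor X (biobj tensor Y Z));
  assoc_iso : forall X Y Z : C, is_iso (assoc X Y Z);
  assoc_natural : forall (X X' Y Y' Z Z' : C)
      (f : Hom X X') (g : Hom Y Y') (h : Hom Z Z'),
    assoc X' Y' Z' ∘ bimap tensor (bimap tensor f g) h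
    = bimap tensor f (bimap tensor g h) ∘ assoc X Y Z;
  pentagon : forall W X Y Z : C,
    bimap tensor (id W) (assoc X Y Z)
      ∘ assoc W (biobj tensor X Y) Z
      ∘ bimap tensor (assoc W X Y) (id Z)
    = assoc W X (biobj tensor Y Z) ∘ assoc (biobj tensor W X) Y Z
}.
Arguments assoc {_} _ _ _ _.

(** * Triples and their algebras *)

Record Triple (C : Category) := {
  endo :> Functor C C;
  mu : forall X : C, Hom (endo (endo X)) (endo X);
  mu_natural : forall (X Y : C) (f : Hom X Y),
    mu Y ∘ fmap endo (fmap endo f) = fmap endo f ∘ mu X;
  eta : forall X : C, Hom X (endo X);
  eta_natural : forall (X Y : C) (f : Hom X Y),
    eta Y ∘ f = fmap endo f ∘ eta X;
  mu_assoc : forall X : C, mu X ∘ fmap endo (mu X) = mu X ∘ mu (endo X);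
  mu_eta_l : forall X : C, mu X ∘ eta (endo X) = id (endo X);
  mu_eta_r : forall X : C, mu X ∘ fmap endo (eta X) = id (endo X)
}.
Arguments mu {_} _ _.
Arguments eta {_} _ _.

Section Algebras.
Variables (C : Category) (T : Triple C).

Definition is_algebra (A : C) (alpha : Hom (T A) A) : Prop :=
  alpha ∘ eta T A = id A /\ alpha ∘ mu T A = alpha ∘ fmap T alpha.

Record Algebra := {
  carrier : C;
  str : Hom (T carrier) carrier;
  algebraP : is_algebra str
}.

Definition is_algebra_map (A B : Algebra) (f : Hom (carrier A) (carrier B)) :
  Prop := f ∘ str A = str B ∘ fmap T f.

Definition AlgHom (A B : Algebra) : Type := {f | @is_algebra_map A B f}.

Lemma AlgHom_eq (A B : Algebra) (f g : AlgHom A B) :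
  proj1_sig f = proj1_sig g -> f = g.
Proof. apply eq_sig_hprop; intros; apply proof_irrelevance. Qed.

Lemma is_algebra_map_id (A : Algebra) : is_algebra_map (id (carrier A)).
Proof. red. now rewrite fmap_id, comp_id_l, comp_id_r. Qed.

Lemma is_algebra_map_comp (X Y Z : Algebra)
    (g : Hom (carrier Y) (carrier Z)) (f : Hom (carrier X) (carrier Y)) :
  is_algebra_map g -> is_algebra_map f -> is_algebra_map (g ∘ f).
Proof.
  unfold is_algebra_map; intros Hg Hf.
  now rewrite fmap_comp, <- comp_assoc, Hf, !comp_assoc, Hg.
Qed.

Definition AlgC : Category.
Proof.
  refine {| Obj := Algebra;
            Hom := AlgHom;
            id := fun A => exist _ (id (carrier A)) (is_algebra_map_id A);
            comp := fun _ _ _ g f =>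
              exist _ (proj1_sig g ∘ proj1_sig f)
                (is_algebra_map_comp (proj2_sig g) (proj2_sig f)) |}.
  - abstract (intros; apply AlgHom_eq; apply comp_id_l).
  - abstract (intros; apply AlgHom_eq; apply comp_id_r).
  - abstract (intros; apply AlgHom_eq; apply comp_assoc).
Defined.

Definition forgetful : Functor AlgC C :=
  @Build_Functor AlgC C carrier (fun _ _ f => proj1_sig f)
    (fun _ => eq_refl) (fun _ _ _ _ _ => eq_refl).

Lemma forgetful_reflects_iso (A B : AlgC) (f : Hom A B) :
  is_iso (fmap forgetful f) -> is_iso f.
Proof.
  destruct f as [f Hf]; cbn; intros [g [gf fg]].
  assert (Hg : @is_algebra_map B A g).
  { unfold is_algebra_map in *.
    rewrite <- (comp_id_r (str B)), <- fmap_id, <- fg, fmap_comp.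
    rewrite (comp_assoc (str B)), <- Hf, !comp_assoc, gf.
    now rewrite comp_id_l. }
  exists (exist _ g Hg); split; apply AlgHom_eq; assumption.
Qed.
End Algebras.

(** * Hopf-like triples and the product of algebras *)

Record HopfLikeTriple (C : Category) (P : AssocProduct C) := {
  triple :> Triple C;
  tau : forall X Y : C,
    Hom (triple (biobj P X Y)) (biobj P (triple X) (triple Y));
  tau_natural : forall (X X' Y Y' : C) (f : Hom X X') (g : Hom Y Y'),
    tau X' Y' ∘ fmap triple (bimap P f g)
    = bimap P (fmap triple f) (fmap triple g) ∘ tau X Y;
  tau_mu : forall X Y : C,
    tau X Y ∘ mu triple (biobj P X Y)
    = bimap P (mu triple X) (mu triple Y)
        ∘ tau (triple X) (triple Y) ∘ fmap triple (tau X Y);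
  tau_assoc : forall X Y Z : C,
    bimap P (id (triple X)) (tau Y Z)
      ∘ tau X (biobj P Y Z) ∘ fmap triple (assoc P X Y Z)
    = assoc P (triple X) (triple Y) (triple Z)
        ∘ bimap P (tau X Y) (id (triple Z)) ∘ tau (biobj P X Y) Z
}.
Arguments tau {_ _} _ _ _.

Section ProductOfAlgebras.
Variables (C : Category) (P : AssocProduct C) (T : HopfLikeTriple P).

Definition circ_str (A B : Algebra T) :
  Hom (T (biobj P (carrier A) (carrier B))) (biobj P (carrier A) (carrier B)) :=
  bimap P (str A) (str B) ∘ tau T (carrier A) (carrier B).

(** [HopfLikeTriple] does not relate [tau] to [eta], so nothing in it makes
    [circ_str A B] unital.  That [circ_str] defines a product of algebras is
    therefore stated separately; by [circ_closedP] below it amounts exactly to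
    [tau ∘ eta = eta ⊗ eta]. *)
Definition circ_closed : Prop :=
  forall A B : Algebra T, is_algebra (circ_str A B).

Lemma circ_str_mu (A B : Algebra T) :
  circ_str A B ∘ mu T (biobj P (carrier A) (carrier B))
  = circ_str A B ∘ fmap T (circ_str A B).
Proof.
  destruct A as [A a [a1 a2]], B as [B b [b1 b2]]; unfold circ_str; cbn in *.
  transitivity (bimap P a b ∘ (tau T A B ∘ mu T (biobj P A B))).
  { now rewrite comp_assoc. }
  rewrite tau_mu, fmap_comp, !comp_assoc.
  f_equal.
  rewrite <- bimap_comp, a2, b2, bimap_comp.
  rewrite <- !comp_assoc; f_equal.
  symmetry; apply tau_natural.
Qed.

Lemma circ_closedP :
  circ_closed <->
  forall X Y : C, tau T X Y ∘ eta T (biobj P X Y) = bimap P (eta T X) (eta T Y).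
Proof.
  split; [intros cl X Y | intros tau_eta A B; split; [|apply circ_str_mu]].
  - assert (free : forall Z : C, is_algebra (mu T Z)).
    { intros Z; split; [apply mu_eta_l | symmetry; apply mu_assoc]. }
    destruct (cl (Build_Algebra (free X)) (Build_Algebra (free Y))) as [H _].
    cbn in H; unfold circ_str in H; cbn in H.
    apply (f_equal (fun h => h ∘ bimap P (eta T X) (eta T Y))) in H.
    rewrite comp_id_l in H; rewrite <- H; clear H.
    rewrite <- !comp_assoc.
    rewrite eta_natural.
    rewrite (comp_assoc (tau T _ _)), tau_natural, !comp_assoc, <- bimap_comp.
    now rewrite !mu_eta_r, bimap_id, comp_id_l.
  - unfold circ_str. rewrite <- comp_assoc, tau_eta, <- bimap_comp.
    now rewrite (proj1 (algebraP A)), (proj1 (algebraP B)), bimap_id.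
Qed.

Hypothesis closed : circ_closed.

Definition circ_obj (A B : Algebra T) : Algebra T :=
  Build_Algebra (closed A B).

Lemma circ_map (A A' B B' : Algebra T)
    (f : Hom (carrier A) (carrier A')) (g : Hom (carrier B) (carrier B')) :
  is_algebra_map f -> is_algebra_map g ->
  @is_algebra_map _ _ (circ_obj A B) (circ_obj A' B') (bimap P f g).
Proof.
  unfold is_algebra_map; cbn; unfold circ_str; intros Hf Hg.
  now rewrite comp_assoc, <- bimap_comp, Hf, Hg, bimap_comp, <- !comp_assoc,
    tau_natural.
Qed.

Definition circF : Functor (prodC (AlgC T) (AlgC T)) (AlgC T).
Proof.
  refine (@Build_Functor (prodC (AlgC T) (AlgC T)) (AlgC T)
            (fun p => circ_obj (fst p) (snd p))
            (fun p q f =>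
               exist _ (bimap P (proj1_sig (fst f)) (proj1_sig (snd f)))
                 (circ_map (proj2_sig (fst f)) (proj2_sig (snd f)))) _ _).
  - abstract (intros [A B]; apply AlgHom_eq; apply bimap_id).
  - abstract (intros X Y Z g f; apply AlgHom_eq; apply bimap_comp).
Defined.

Lemma circ_assoc_map (X Y Z : Algebra T) :
  @is_algebra_map _ _ (circ_obj (circ_obj X Y) Z) (circ_obj X (circ_obj Y Z))
    (assoc P (carrier X) (carrier Y) (carrier Z)).
Proof.
  destruct X as [X x x0], Y as [Y y y0], Z as [Z z z0].
  unfold is_algebra_map; cbn; unfold circ_str; cbn; unfold circ_str; cbn.
  replace (bimap P (bimap P x y ∘ tau T X Y) z)
    with (bimap P (bimap P x y) z ∘ bimap P (tau T X Y) (id _))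
    by now rewrite <- bimap_comp, comp_id_r.
  replace (bimap P x (bimap P y z ∘ tau T Y Z))
    with (bimap P x (bimap P y z) ∘ bimap P (id _) (tau T Y Z))
    by now rewrite <- bimap_comp, comp_id_r.
  rewrite !comp_assoc, assoc_natural.
  rewrite <- !comp_assoc; f_equal.
  rewrite !comp_assoc; symmetry; apply tau_assoc.
Qed.

(** The product [○] on [T]-algebras; it extends [P], associativity included. *)
Definition circ : AssocProduct (AlgC T).
Proof.
  refine (@Build_AssocProduct (AlgC T) circF
            (fun X Y Z => exist _ _ (circ_assoc_map X Y Z)) _ _ _).
  - abstract (intros; apply forgetful_reflects_iso; apply assoc_iso).
  - abstract (intros; apply AlgHom_eq; apply assoc_natural).
  - abstract (intros; apply AlgHom_eq; apply pentagon).
Defined.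
End ProductOfAlgebras.

(* Main.v *)
Require Import Defs.
From Stdlib Require Import IndefiniteDescription.

(** The result is an adjoint lifting theorem.  Write [S] for [U(A) ⊗ -] and [R]
    for [A ○ -], so that [U R = S U].  Both [S] and [U] have left adjoints (that
    of [U] is the free algebra functor), hence so does [U R].

    Fix an algebra [(B, b)] and let [w : B -> U R X0] be a universal arrow from
    the bare object [B] to [U R].  An arrow [f : B -> U R Y] is then the same as
    an algebra map [k : X0 -> Y].  It underlies an algebra map [B -> R Y]
    exactly when two arrows [T B -> U R Y] agree, namely [f ∘ b] and
    [str (R Y) ∘ T f].  Both are natural in [Y], so through a universal arrow
    from [T B] to [U R] they correspond to [k ∘ s] and [k ∘ t] for two fixed
    algebra maps [s] and [t] into [X0].  Therefore the algebra maps [B -> R Y]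
    correspond to the maps out of the coequalizer of [s] and [t], which gives a
    universal arrow from [(B, b)] to [R].  This is
    [universal_arrow_lift_algebra]; nothing in it is specific to tensor products,
    so it is stated for an arbitrary functor into algebras.

    Working with universal arrows rather than with units and counits keeps the
    lifting step local to one algebra; the two presentations of adjoints are
    compared in [left_adjoint_of_universal_arrows] and
    [universal_arrows_of_left_adjoint]. *)

Local Open Scope cat_scope.

Definition is_universal_arrow (C D : Category) (R : Functor D C)
    (X : C) (L : D) (u : Hom X (R L)) : Prop :=
  forall (Y : D) (f : Hom X (R Y)), exists! g : Hom L Y, fmap R g ∘ u = f.

Definition has_universal_arrow (C D : Category) (R : Functor D C) (X : C) :
  Prop :=
  exists (L : D) (u : Hom X (R L)), is_universal_arrow _ _ R X L u.

Arguments is_universal_arrow {C D} R {X L} u.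
Arguments has_universal_arrow {C D} R X.

Lemma universal_arrow_ext (C D : Category) (R : Functor D C) (X : C) (L : D)
    (u : Hom X (R L)) (Y : D) (g h : Hom L Y) :
  is_universal_arrow R u -> fmap R g ∘ u = fmap R h ∘ u -> g = h.
Proof.
  intros Hu E. destruct (Hu Y (fmap R h ∘ u)) as [k [_ Hk]].
  rewrite <- (Hk g E). now apply Hk.
Qed.
Arguments universal_arrow_ext {C D R X L u Y g h} _ _.

Lemma universal_arrows_of_left_adjoint (C D : Category) (R : Functor D C) :
  has_left_adjoint R -> forall X : C, has_universal_arrow R X.
Proof.
  intros [L [unit [counit [tri_L tri_R]]]] X.
  exists (L X), (unit X). intros Y f.
  exists (counit Y ∘ fmap L f). split.
  - rewrite fmap_comp, <- comp_assoc.
    pose proof (naturality unit f) as N; cbn in *.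
    now rewrite <- N, comp_assoc, tri_R, comp_id_l.
  - intros g <-.
    pose proof (naturality counit g) as N; cbn in *.
    now rewrite fmap_comp, comp_assoc, N, <- comp_assoc, tri_L, comp_id_r.
Qed.

(** Universal arrows merely exist, so a choice principle is what turns them into
    a functor: one picks an arrow for every object, and then unique
    factorization determines the action on morphisms and the counit. *)
Lemma left_adjoint_of_universal_arrows (C D : Category) (R : Functor D C) :
  (forall X : C, has_universal_arrow R X) -> has_left_adjoint R.
Proof.
  intros H.
  pose (L X := proj1_sig (constructive_indefinite_description _ (H X))).
  pose (HL X := proj2_sig (constructive_indefinite_description _ (H X))).
  pose (u X := proj1_sig (constructive_indefinite_description _ (HL X))
               : Hom X (R (L X))).
  assert (Hu : forall X, is_universal_arrow R (u X)).
  { intros X.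
    exact (proj2_sig (constructive_indefinite_description _ (HL X))). }
  clearbody u. clear HL. clearbody L. clear H.
  assert (D0 : forall X Y (f : Hom X (R Y)),
            {g : Hom (L X) Y | fmap R g ∘ u X = f}).
  { intros X Y f. apply constructive_indefinite_description.
    destruct (Hu X Y f) as [g [Hg _]]. now exists g. }
  pose (tr X Y f := proj1_sig (D0 X Y f)).
  assert (trE : forall X Y f, fmap R (tr X Y f) ∘ u X = f).
  { intros X Y f. exact (proj2_sig (D0 X Y f)). }
  clearbody tr. clear D0.
  pose (Lmap X Y (f : Hom X Y) := tr X (L Y) (u Y ∘ f)).
  assert (LmapE : forall X Y (f : Hom X Y), fmap R (Lmap X Y f) ∘ u X = u Y ∘ f)
    by (intros; apply trE).
  assert (Lid : forall X, Lmap X X (id X) = id (L X)).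
  { intros X. apply (universal_arrow_ext (Hu X)).
    now rewrite LmapE, fmap_id, comp_id_l, comp_id_r. }
  assert (Lcomp : forall X Y Z (g : Hom Y Z) (f : Hom X Y),
            Lmap X Z (g ∘ f) = Lmap Y Z g ∘ Lmap X Y f).
  { intros X Y Z g f. apply (universal_arrow_ext (Hu X)).
    now rewrite LmapE, fmap_comp, <- comp_assoc, LmapE, !comp_assoc,
      LmapE. }
  pose (LF := {| fobj := L; fmap := Lmap; fmap_id := Lid;
                 fmap_comp := Lcomp |} : Functor C D).
  assert (unit_nat : forall X Y (f : Hom X Y),
            u Y ∘ fmap (idF C) f = fmap (compF R LF) f ∘ u X).
  { intros X Y f. cbn. symmetry. apply LmapE. }
  assert (counit_nat : forall X Y (f : Hom X Y),
            tr (R Y) Y (id _) ∘ fmap (compF LF R) f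
            = fmap (idF D) f ∘ tr (R X) X (id _)).
  { intros X Y f.
    change (tr (R Y) Y (id _) ∘ Lmap (R X) (R Y) (fmap R f)
            = f ∘ tr (R X) X (id _)).
    apply (universal_arrow_ext (Hu (R X))).
    now rewrite !fmap_comp, <- !comp_assoc, LmapE, trE, comp_assoc, trE,
      comp_id_l, comp_id_r. }
  exists LF,
    (@Build_NatTrans C C (idF C) (compF R LF) u unit_nat),
    (@Build_NatTrans D D (compF LF R) (idF D) (fun Y => tr (R Y) Y (id _))
       counit_nat).
  split; cbn.
  - intros X.
    change (tr (R (L X)) (L X) (id _) ∘ Lmap X (R (L X)) (u X) = id (L X)).
    apply (universal_arrow_ext (Hu X)).
    now rewrite fmap_comp, <- comp_assoc, LmapE, comp_assoc, trE, fmap_id.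
  - intros Y. apply trE.
Qed.

Lemma universal_arrow_comp (C D E : Category) (S : Functor D C)
    (U : Functor E D) (X : C) :
  has_universal_arrow S X -> (forall Y : D, has_universal_arrow U Y) ->
  has_universal_arrow (compF S U) X.
Proof.
  intros [L [u Hu]] HU. destruct (HU L) as [M [v Hv]].
  exists M, (fmap S v ∘ u). intros Y f.
  destruct (Hu (U Y) f) as [g [Hg _]].
  destruct (Hv Y g) as [h [Hh _]].
  exists h. split.
  - cbn. now rewrite comp_assoc, <- fmap_comp, Hh.
  - intros k Hk. apply (universal_arrow_ext Hv).
    apply (universal_arrow_ext Hu).
    now rewrite Hh, Hg, fmap_comp, <- comp_assoc.
Qed.

(** The universal arrow is [eta T X : X -> T X] into the free algebra, and
    [f : X -> Y] extends along it to [str Y ∘ fmap T f]. *)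
Lemma free_algebra_universal (C : Category) (T : Triple C) (X : C) :
  has_universal_arrow (forgetful T) X.
Proof.
  assert (free : is_algebra (mu T X)).
  { split; [apply mu_eta_l | symmetry; apply mu_assoc]. }
  exists (Build_Algebra free), (eta T X). cbn. intros Y f.
  destruct (algebraP Y) as [Y1 Y2].
  assert (Hg : @is_algebra_map _ _ (Build_Algebra free) Y
                 (str Y ∘ fmap T f)).
  { unfold is_algebra_map; cbn.
    now rewrite fmap_comp, comp_assoc, <- Y2, <- !comp_assoc, mu_natural. }
  exists (exist _ _ Hg). split; cbn.
  - now rewrite <- comp_assoc, <- eta_natural, comp_assoc, Y1, comp_id_l.
  - intros [g Gg] <-. apply AlgHom_eq. cbn in *.
    unfold is_algebra_map in Gg; cbn in Gg.
    now rewrite fmap_comp, comp_assoc, <- Gg, <- comp_assoc, mu_eta_r,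
      comp_id_r.
Qed.

(** The equation saying that [w : B -> R X0] is an algebra map compares two
    arrows out of [T B].  Coequalizing their transposes [s] and [t] imposes it
    on [w] in the universal way. *)
Lemma universal_arrow_lift_algebra (C D : Category) (T : Triple C)
    (R : Functor D (AlgC T)) :
  has_coequalizers D ->
  (forall X : C, has_universal_arrow (compF (forgetful T) R) X) ->
  forall B : AlgC T, has_universal_arrow R B.
Proof.
  intros coeq univ B.
  (* [V] is the action on morphisms of the composite of [R] with the forgetful
     functor, typed so that sources and targets are visibly carriers. *)
  pose (V X Y (k : Hom X Y) :=
          proj1_sig (fmap R k) : Hom (carrier (R X)) (carrier (R Y))).
  assert (V_alg : forall X Y (k : Hom X Y),
            V X Y k ∘ str (R X) = str (R Y) ∘ fmap T (V X Y k))
    by (intros X Y k; exact (proj2_sig (fmap R k))).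
  assert (V_comp : forall X Y Z (h : Hom Y Z) (k : Hom X Y),
            V X Z (h ∘ k) = V Y Z h ∘ V X Y k)
    by (intros; exact (fmap_comp (compF (forgetful T) R) _ _)).
  assert (V_univ : forall X : C, exists (L : D) (u : Hom X (carrier (R L))),
            forall Y (f : Hom X (carrier (R Y))),
              exists! g : Hom L Y, V L Y g ∘ u = f)
    by exact univ.
  assert (V_ext : forall X L (u : Hom X (carrier (R L))),
            (forall Y (f : Hom X (carrier (R Y))),
              exists! g : Hom L Y, V L Y g ∘ u = f) ->
            forall Y (g h : Hom L Y), V L Y g ∘ u = V L Y h ∘ u -> g = h).
  { intros X L u Hu Y g h.
    exact (@universal_arrow_ext _ _ (compF (forgetful T) R) X L u Y g h Hu). }
  destruct (V_univ (carrier B)) as [X0 [w Hw]].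
  destruct (V_univ (T (carrier B))) as [X1 [w' Hw']].
  destruct (Hw' X0 (w ∘ str B)) as [s [Hs _]].
  destruct (Hw' X0 (str (R X0) ∘ fmap T w)) as [t [Ht _]].
  destruct (coeq _ _ s t) as [Q [q [Hq q_univ]]].
  assert (u_alg : @is_algebra_map _ _ B (R Q) (V X0 Q q ∘ w)).
  { unfold is_algebra_map.
    rewrite fmap_comp, comp_assoc, <- V_alg, <- !comp_assoc.
    rewrite <- Hs, <- Ht, !comp_assoc, <- !V_comp.
    now rewrite Hq. }
  exists Q, (exist _ _ u_alg). intros Y [f Hf].
  destruct (Hw Y f) as [k [Hk _]].
  assert (k_coeq : k ∘ s = k ∘ t).
  { apply (V_ext _ _ _ Hw').
    unfold is_algebra_map in Hf.
    rewrite !V_comp, <- !comp_assoc, Hs, Ht, !comp_assoc, V_alg.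
    now rewrite Hk, Hf, <- comp_assoc, <- fmap_comp, Hk. }
  destruct (q_univ Y k k_coeq) as [g [Hg g_uniq]].
  exists g. split.
  - apply AlgHom_eq. change (V Q Y g ∘ (V X0 Q q ∘ w) = f).
    now rewrite comp_assoc, <- V_comp, Hg.
  - intros h Hh. apply g_uniq.
    apply (V_ext _ _ _ Hw).
    apply (f_equal (@proj1_sig _ _)) in Hh.
    change (V Q Y h ∘ (V X0 Q q ∘ w) = f) in Hh.
    now rewrite Hk, V_comp, <- comp_assoc.
Qed.

Theorem proposition3p1p4
    (C : Category) (P : AssocProduct C) (T : HopfLikeTriple P)
    (closed : circ_closed T)
    (coeq : has_coequalizers (AlgC T))
    (adj : forall A : AlgC T, has_left_adjoint (fix_left P (forgetful T A))) :
  forall A : AlgC T, has_left_adjoint (fix_left (circ closed) A).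
Proof.
  intros A. apply left_adjoint_of_universal_arrows.
  apply universal_arrow_lift_algebra; [exact coeq|]. intros X.
  (* [U (A ○ -)] and [U(A) ⊗ U(-)] have convertible actions on objects and on
     morphisms, hence the same universal arrows. *)
  change (has_universal_arrow
            (compF (fix_left P (forgetful T A)) (forgetful T)) X).
  apply universal_arrow_comp.
  - now apply universal_arrows_of_left_adjoint.
  - apply free_algebra_universal.
Qed.
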